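(* Let $(P,\preceq)$ be an infinite, locally finite lattice and let $S_n=\{x_1,\dots,x_n\}$ be a set of $n$ distinct elements of $P$. (1) If the set $A=\{x_i\wedge x_j: i\ne j\}$ is a chain (i.e. $S_n$ is an $A$-set), then $S_n$ is a $\wedge$-tree set. (2) If the set $\{x_i\vee x_j: i\ne j\}$ is a chain (i.e. the dual of $S_n$ is an $A$-set), then $S_n$ is a $\vee$-tree set.
   Context: $\mathrm{meetcl}(S_n)$ (resp. $\mathrm{joincl}(S_n)$) denotes the smallest subset of $P$ containing $S_n$ and closed under meet $\wedge$ (resp. join $\vee$). $S_n$ is a $\wedge$-tree set if the Hasse diagram of $\mathrm{meetcl}(S_n)$, regarded as an undirected graph, is a tree; it is a $\vee$-tree set if the Hasse diagram of $\mathrm{joincl}(S_n)$ is a tree. *)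

(* Defs.v *)
From mathcomp Require Import all_boot all_order.
From mathcomp Require Import boolp classical_sets cardinality.

Set Implicit Arguments.
Unset Strict Implicit.
Unset Printing Implicit Defensive.

Import Order.Theory.
Local Open Scope classical_set_scope.

Section Graph.
Variable T : choiceType.
Implicit Types (V : set T) (e : rel T).

(* The graph has vertex set V and adjacency relation e, where e is meant to be
   symmetric, irreflexive and to relate elements of V only. *)
Definition connected_graph V e : Prop :=
  forall u v, V u -> V v -> exists2 p : seq T, path e u p & last u p = v.

(* As e is symmetric, an edge {u, v} makes [:: u; v] a simple e-cycle in the
   sense of ucycle; the cycles of the undirected graph are those with at least
   three vertices. *)
Definition acyclic_graph e : Prop :=
  forall c : seq T, ucycle e c -> size c < 3.

Definition is_tree V e : Prop :=
  [/\ V !=set0, connected_graph V e & acyclic_graph e].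

End Graph.

Section Lattice.
Variables (d : Order.disp_t) (P : latticeType d).
Implicit Types (S M : set P).

Definition locally_finite : Prop :=
  forall a b : P, finite_set [set z : P | (a <= z <= b)%O].

Definition chain S : Prop := total_on S (fun a b => (a <= b)%O).

Definition meet_closed M : Prop :=
  forall a b, M a -> M b -> M (Order.meet a b).

Definition join_closed M : Prop :=
  forall a b, M a -> M b -> M (Order.join a b).

Definition meetcl S : set P := smallest meet_closed S.

Definition joincl S : set P := smallest join_closed S.

(* b covers a in the subposet M, with the order induced from P. *)
Definition covered_in M (a b : P) : Prop :=
  [/\ M a, M b, (a < b)%O & forall z, M z -> ~ (a < z < b)%O].

Definition hasse M : rel P :=
  fun a b => `[< covered_in M a b \/ covered_in M b a >].

Definition meet_tree_set S : Prop := is_tree (meetcl S) (hasse (meetcl S)).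

Definition join_tree_set S : Prop := is_tree (joincl S) (hasse (joincl S)).

Definition pairwise_meets (n : nat) (x : 'I_n -> P) : set P :=
  [set a | exists i j, i != j /\ a = Order.meet (x i) (x j)].

Definition pairwise_joins (n : nat) (x : 'I_n -> P) : set P :=
  [set a | exists i j, i != j /\ a = Order.join (x i) (x j)].

End Lattice.

Arguments locally_finite {d} P.

(* Main.v *)
(** If the meets of distinct elements of [S] form a chain [A], then
    [meetcl S = S `|` A], and everything strictly below an element of this set
    lies in [A].  Hence every element has at most one lower cover, so the
    maximal vertex of a cycle of the Hasse diagram would have two equal
    neighbours; connectedness holds because any two elements are joined to
    their meet by saturated chains.  The second part is the first one in the
    dual lattice. *)
Require Import Defs.
From mathcomp Require Import all_boot all_order.
From mathcomp Require Import boolp classical_sets cardinality.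

Local Open Scope classical_set_scope.
Import Order.Theory.

Definition reachable {T : Type} (e : rel T) (u v : T) : Prop :=
  exists2 p : seq T, path e u p & last u p = v.

Lemma reachable_trans (T : Type) (e : rel T) (u v w : T) :
  reachable e u v -> reachable e v w -> reachable e u w.
Proof.
move=> [p ep <-] [q eq <-]; exists (p ++ q); last by rewrite last_cat.
by rewrite cat_path ep.
Qed.

Section HasseDiagram.
Variables (d : Order.disp_t) (P : latticeType d).
Implicit Types (M : set P).

(** The list [s] serves as a finite bound on the open interval between [u] and [v], and the
    induction is on its size. If [v] does not cover [u] in [M], some [z] of [M] lies strictly
    between them; it belongs to neither open half, so [rem z s] bounds both. *)
Lemma reachable_hasse_le M (s : seq P) (u v : P) : M u -> M v -> (u <= v)%O ->
    (forall z, (u < z < v)%O -> z \in s) ->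
  reachable (hasse M) u v /\ reachable (hasse M) v u.
Proof.
have [n] := ubnP (size s); elim: n => // n IHn in s u v *.
rewrite ltnS => sn Mu Mv; rewrite le_eqVlt => /orP[/eqP <- _|uv us].
  by split; exists [::].
have [cuv|ncuv] := pselect (covered_in M u v).
  split; [exists [:: v] => //=|exists [:: u] => //=]; rewrite andbT.
    by apply/asboolP; left.
  by apply/asboolP; right.
have [z Mz /andP[uz zv]] : exists2 z, M z & (u < z < v)%O.
  apply: contrapT => nz; apply: ncuv.
  by split=> // z Mz uzv; apply: nz; exists z.
have zs : z \in s by rewrite us ?uz.
have szn : (size (rem z s) < n)%N.
  by rewrite size_rem // (leq_trans _ sn) // prednK // -has_predT; apply/hasP; exists z.
have memrem (t : P) : (u < t < v)%O -> t != z -> t \in rem z s.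
  by move=> /us + /negPf tz; rewrite (perm_mem (perm_to_rem zs)) inE tz.
have [|uz1 uz2] := IHn (rem z s) u z szn Mu Mz (ltW uz).
  by move=> t /andP[ut tz]; rewrite memrem ?ut ?(lt_trans tz) ?lt_eqF.
have [|zv1 zv2] := IHn (rem z s) z v szn Mz Mv (ltW zv).
  by move=> t /andP[zt tv]; rewrite memrem ?tv ?(lt_trans uz) ?gt_eqF.
by split; [exact: reachable_trans zv1|exact: reachable_trans uz2].
Qed.

Lemma connected_hasse M : locally_finite P -> Defs.meet_closed M ->
  connected_graph M (hasse M).
Proof.
move=> finP meetM u v Mu Mv.
have reach w : M w -> (Order.meet u v <= w)%O ->
    reachable (hasse M) (Order.meet u v) w /\
    reachable (hasse M) w (Order.meet u v).
  (* Local finiteness supplies the bounding list: an enumeration of the closed interval. *)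
  move=> Mw uvw; have /finite_seqP[s sE] := finP (Order.meet u v) w.
  apply: (reachable_hasse_le M s) => //; first exact: meetM.
  move=> z /andP[uvz zw].
  suff : [set` s] z by [].
  by rewrite -sE /= (ltW uvz) (ltW zw).
apply: (@reachable_trans _ _ _ (Order.meet u v)).
  by have [] := reach u Mu (leIl _ _).
by have [] := reach v Mv (leIr _ _).
Qed.

(** The order is only partial, so the candidate [z] from the tail gives way to the head only when
    strictly below it; transitivity then keeps the new candidate maximal. *)
Lemma exists_maximal_seq (a : P) (s : seq P) :
  exists2 z, z \in a :: s & forall y, y \in a :: s -> ~~ (z < y)%O.
Proof.
elim: s a => [|b s IHs] a.
  by exists a; rewrite ?mem_head // => y; rewrite inE => /eqP ->; rewrite ltxx.
have [z zs zmax] := IHs b; have [za|nza] := boolP (z < a)%O.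
  exists a; first exact: mem_head.
  move=> y; rewrite inE => /orP[/eqP ->|/zmax]; first by rewrite ltxx.
  by apply: contra => /(lt_trans za).
exists z; first by rewrite inE zs orbT.
by move=> y; rewrite inE => /orP[/eqP ->|/zmax].
Qed.

Lemma acyclic_hasse M :
    (forall a b z, covered_in M a z -> covered_in M b z -> a = b) ->
  acyclic_graph (hasse M).
Proof.
move=> cover_uniq c cM; rewrite ltnNge; apply/negP => c3.
have [z zc zmax] : exists2 z, z \in c & forall y, y \in c -> ~~ (z < y)%O.
  by case: (c) c3 => // a s _; exact: exists_maximal_seq.
have [i c' cE] := rot_to zc.
have size_c' : (1 < size c')%N by rewrite -(size_rot i) cE in c3.
have : ucycle (hasse M) (z :: c') by rewrite -cE /ucycle rot_cycle rot_uniq.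
have {}zmax y : y \in c' -> ~~ (z < y)%O.
  by move=> yc'; apply: zmax; rewrite -(mem_rot i) cE inE yc' orbT.
(* The two neighbours of [z] on the cycle are its successor [y] and the last vertex [w]. They are
   distinct because the cycle has at least three vertices and no repetition. *)
case: c' size_c' zmax {cE} => // y c'; case/lastP: c' => // c' w _ zmax.
rewrite /ucycle /= rcons_path last_rcons.
move=> /and4P[/and3P[zy _ wz] _ + _].
rewrite mem_rcons inE negb_or => /andP[yw _].
have cyz : covered_in M y z.
  case/asboolP: zy => // -[_ _ zy _].
  by move: (zmax y); rewrite mem_head zy => /(_ isT).
have cwz : covered_in M w z.
  case/asboolP: wz => // -[_ _ zw _].
  by move: (zmax w); rewrite inE mem_rcons mem_head orbT zw => /(_ isT).
by rewrite (cover_uniq _ _ _ cyz cwz) eqxx in yw.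
Qed.

End HasseDiagram.

Section ChainOfMeets.
Variables (d : Order.disp_t) (P : latticeType d) (n : nat) (x : 'I_n -> P).
Hypothesis chain_meets : chain (pairwise_meets x).

Lemma pairwise_meets_meet_closed : Defs.meet_closed (pairwise_meets x).
Proof.
by move=> a b Aa Ab; case: (chain_meets a b Aa Ab) => [/meet_l|/meet_r] ->.
Qed.

Lemma meet_closed_range_meets : Defs.meet_closed (range x `|` pairwise_meets x).
Proof.
have meetA i a : pairwise_meets x a ->
    pairwise_meets x (Order.meet (x i) a).
  move=> Aa; have [j [k [jk aE]]] := Aa; have [ij|ij] := eqVneq i j.
    by rewrite ij meet_r // aE leIl.
  have [ik|ik] := eqVneq i k; first by rewrite ik meet_r // aE leIr.
  (* Duplicating [x i] regroups the triple meet as a meet of two elements of the chain, since [i]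
     differs from both [j] and [k]. *)
  rewrite aE -[x i]meetxx meetACA; apply: pairwise_meets_meet_closed.
    by exists i, j.
  by exists i, k.
move=> a b [[i _ <-]|Aa] [[j _ <-]|Ab].
- have [->|ij] := eqVneq i j; first by left; exists j; rewrite ?meetxx.
  by right; exists i, j.
- by right; apply: meetA.
- by right; rewrite meetC; apply: meetA.
- by right; exact: pairwise_meets_meet_closed.
Qed.

Lemma meetcl_range : meetcl (range x) `<=` range x `|` pairwise_meets x.
Proof.
by apply: smallest_sub; [exact: meet_closed_range_meets|exact: subsetUl].
Qed.

(** It suffices to treat [a = x i] and to find an index [j] other than [i] with [x i <= x j], for
    then [x i] is the meet of [x i] and [x j]. *)
Lemma lt_meetcl_pairwise_meets (a b : P) :
    meetcl (range x) a -> meetcl (range x) b -> (a < b)%O ->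
  pairwise_meets x a.
Proof.
move=> /meetcl_range[[i _ <-]|//] Mb ltb.
have le_meets j : (x i <= x j)%O -> i != j -> pairwise_meets x (x i).
  by move=> le_ij ij; exists i, j; rewrite meet_l.
case/meetcl_range: Mb => [[j _ bj]|[j [k [jk bE]]]].
  by apply: (le_meets j); [rewrite bj ltW|apply: contraTneq ltb => ->; rewrite bj ltxx].
have [lej lek] : (x i <= x j)%O /\ (x i <= x k)%O.
  by apply/andP; rewrite -lexI -bE ltW.
(* As [j] and [k] differ, at least one of them is not [i]. *)
have [ij|] := eqVneq i j; last exact: le_meets.
by apply: (le_meets k) => //; rewrite ij.
Qed.

(** Both lower covers lie in the chain of meets, so they are comparable; if they were distinct, the
    larger would lie strictly between the smaller and [z]. *)
Lemma covered_in_meetcl_uniq (a b z : P) :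
  covered_in (meetcl (range x)) a z -> covered_in (meetcl (range x)) b z ->
  a = b.
Proof.
move=> [Ma Mz az naz] [Mb _ bz nbz].
have Aa := lt_meetcl_pairwise_meets _ _ Ma Mz az.
have Ab := lt_meetcl_pairwise_meets _ _ Mb Mz bz.
case: (chain_meets a b Aa Ab); rewrite le_eqVlt => /orP[/eqP//|ltab].
  by case: (naz b Mb); rewrite ltab.
by case: (nbz a Ma); rewrite ltab.
Qed.

Lemma chain_meet_tree_set :
  locally_finite P -> (0 < n)%N -> meet_tree_set (range x).
Proof.
move=> finP n_gt0; split.
- by exists (x (Ordinal n_gt0)) => M [_]; apply; exists (Ordinal n_gt0).
- apply: connected_hasse => // a b Ma Mb M [Mclosed SM].
  by apply: (Mclosed); [apply: Ma|apply: Mb].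
- apply: acyclic_hasse; exact: covered_in_meetcl_uniq.
Qed.

End ChainOfMeets.

Lemma locally_finite_dual (d : Order.disp_t) (P : latticeType d) :
  locally_finite P -> locally_finite P^d.
Proof.
move=> finP a b; apply: sub_finite_set (finP b a) => z /= /andP[az zb].
by apply/andP; split.
Qed.

(** Duality reverses covers, and the Hasse adjacency is symmetric in its two arguments. *)
Lemma hasse_dual (d : Order.disp_t) (P : latticeType d) (M : set P) :
  @hasse _ P^d M = hasse M.
Proof.
have covered_dual a b : @covered_in _ P^d M a b = covered_in M b a.
  by rewrite propeqE; split=> -[Ma Mb ab nab]; split=> // z Mz;
    rewrite andbC; exact: nab.
apply/funext => a; apply/funext => b; rewrite /hasse !covered_dual.
by apply: asbool_equiv_eq; split=> -[]; [right|left|right|left].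
Qed.

Theorem theorem4p8 (d : Order.disp_t) (P : latticeType d)
    (P_infinite : infinite_set [set: P]) (P_locfin : locally_finite P)
    (n : nat) (n_gt0 : (0 < n)%N) (x : 'I_n -> P) (x_inj : injective x) :
  (chain (pairwise_meets x) -> meet_tree_set (range x)) /\
  (chain (pairwise_joins x) -> join_tree_set (range x)).
Proof.
split=> [chain_meets|chain_joins]; first exact: chain_meet_tree_set.
have chain_dual : chain (@pairwise_meets _ P^d n x).
  by move=> a b Aa Ab; case: (chain_joins a b Aa Ab); [right|left].
(* Meets in [P^d] are by definition joins in [P], so [meetcl] in the dual is convertible to
   [joincl]; only the Hasse relation needs rewriting. *)
have := @chain_meet_tree_set _ P^d n x chain_dual
  (locally_finite_dual _ P P_locfin) n_gt0.
by rewrite /meet_tree_set hasse_dual.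
Qed.
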